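(* Let $n\le m$ and let $\langle A,B\rangle$, with $A=\mathcal M^-\in\mathbb R^{n\times m}_{\ge 0}$ and $B=\mathcal M^+\in\mathbb R^{n\times m}_{\ge 0}$, be the repressors and supporters gain matrices of an irreducible nonnegative system $\mathcal L=\langle \mathcal M^+,\mathcal M^-\rangle$. Let $\beta^*$ be the optimal value of the problem: maximize $\beta$ subject to $A\overline X\le \frac1\beta B\overline X$, $\|\overline X\|_1=1$, $\overline X\ge \overline 0$. Then $\beta^*=1/r$, where $r\in\mathbb R_{>0}$ is the smallest Perron--Frobenius root of all $n\times n$ square sub-systems of $\mathcal L$, i.e. $r=\min_{F\in\mathcal F(\mathcal L)} r(\mathcal L(F))$. Moreover, there exists a vector $\overline P\ge 0$ in $\mathbb R^m$ such that $A\overline P=r\, B\overline P$, and $\overline P$ has exactly $n$ entries greater than $0$ and $m-n$ zero entries.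
   Context: System: let $n\le m$ be positive integers. A system has entities $v_1,\dots,v_n$, affectors $\mathcal A_1,\dots,\mathcal A_m$ and real gains $g(i,j)$, $1\le i\le n$, $1\le j\le m$. Its supporters and repressors gain matrices are the $n\times m$ nonnegative matrices $\mathcal M^+(i,j)=\max\{g(i,j),0\}$ and $\mathcal M^-(i,j)=\max\{-g(i,j),0\}$, and the system is $\mathcal L=\langle\mathcal M^+,\mathcal M^-\rangle$. Put $\mathcal S_i=\{\mathcal A_j: g(i,j)>0\}$ (supporters of $v_i$). Standing assumptions: $\mathcal S_i\neq\emptyset$ for every $i$, and there are no redundant affectors, i.e. for every $j$ there is $i$ with $g(i,j)>0$. Selections: a matrix $F\in\{0,1\}^{m\times n}$ is a legal selection matrix for $\mathcal L$ if for every $i$ there is exactly one $j$ with $F(j,i)=1$, and for this $j$ one has $\mathcal A_j\in\mathcal S_i$. $\mathcal F(\mathcal L)$ is the set of legal selection matrices. For $F\in\mathcal F(\mathcal L)$, the associated square sub-system is $\mathcal L(F)=\langle \mathcal M^+F,\mathcal M^-F\rangle$ (column $i$ of $\mathcal M^{\pm}F$ is the column of $\mathcal M^{\pm}$ of the supporter selected for $v_i$). Irreducibility: a nonnegative square matrix $C$ is irreducible if for all $i,j$ there is $k\ge1$ with $(C^k)_{i,j}>0$. The system $\mathcal L$ is irreducible if for every $F\in\mathcal F(\mathcal L)$ the matrix $\mathcal M^+F$ is nonsingular and $\mathcal M^-F$ is irreducible. In that case put $Z(\mathcal L(F))=(\mathcal M^+F)^{-1}\mathcal M^-F$ (a nonnegative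 irreducible matrix), and let the Perron--Frobenius root $r(\mathcal L(F))$ be the largest real eigenvalue of $Z(\mathcal L(F))$. Vector inequalities are componentwise. *)

(* Defs.v *)
From HB Require Import structures.
From mathcomp Require Import all_boot all_order all_algebra.
From mathcomp Require Import reals.

Set Implicit Arguments.
Unset Strict Implicit.
Unset Printing Implicit Defensive.

Import Order.TTheory GRing.Theory Num.Theory.
Local Open Scope ring_scope.

Section System.
Variables (R : realType) (n m : nat).

(* A system is given by its matrix of gains: row i is an entity, column j an
   affector, and a positive gain means that the affector supports the entity. *)
Implicit Types (g : 'M[R]_(n, m)) (F : 'M[R]_(m, n)).

Definition supporters_mx g : 'M[R]_(n, m) := \matrix_(i, j) Num.max (g i j) 0.

Definition repressors_mx g : 'M[R]_(n, m) :=
  \matrix_(i, j) Num.max (- g i j) 0.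

Definition supporters g (i : 'I_n) : {set 'I_m} := [set j | 0 < g i j].

Definition legal_selection g F : Prop :=
  (forall j i, F j i = 0 \/ F j i = 1) /\
  (forall i, exists j, [/\ F j i = 1, forall j', F j' i = 1 -> j' = j
                         & j \in supporters g i]).

Definition irreducible_mx (C : 'M[R]_n) : Prop :=
  forall i j, exists k : nat, (1 <= k)%N /\ 0 < (C ^+ k) i j.

Definition irreducible_system g : Prop :=
  forall F, legal_selection g F ->
    supporters_mx g *m F \in unitmx /\ irreducible_mx (repressors_mx g *m F).

Definition subsystem_mx g F : 'M[R]_n :=
  invmx (supporters_mx g *m F) *m (repressors_mx g *m F).

(* The scalar field is real, so this is the largest real eigenvalue. *)
Definition is_PF_root (C : 'M[R]_n) (r : R) : Prop :=
  eigenvalue C r /\ forall a, eigenvalue C a -> a <= r.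

(* The PF root being a relation, its existence for every sub-system is part of
   the assertion, so that the minimum ranges over all legal selections. *)
Definition is_min_PF_root g (r : R) : Prop :=
  (exists F, legal_selection g F /\ is_PF_root (subsystem_mx g F) r) /\
  (forall F, legal_selection g F ->
     exists rF, is_PF_root (subsystem_mx g F) rF /\ r <= rF).

End System.

Section Program.
Variables (R : realType).

Definition le_cV (k : nat) (u v : 'cV[R]_k) : Prop :=
  forall i, u i 0 <= v i 0.

Variables (n m : nat).
Implicit Types (A B : 'M[R]_(n, m)).

Definition feasible A B (beta : R) (X : 'cV[R]_m) : Prop :=
  [/\ 0 < beta, le_cV (A *m X) (beta^-1 *: (B *m X)),
      \sum_j `|X j 0| = 1 & le_cV 0 X].

Definition is_optimal_value A B (beta : R) : Prop :=
  (exists X, feasible A B beta X) /\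
  (forall beta' X, feasible A B beta' X -> beta' <= beta).

End Program.

(* Main.v *)
Require Import Defs.
From HB Require Import structures.
From mathcomp Require Import all_boot all_order all_algebra.
From mathcomp Require Import reals.
From mathcomp Require all_classical topology normedtype derive.


(** Two entities can never share a supporter: a selection giving the same
    affector to both would make two columns of the supporters matrix equal, hence
    that matrix singular ([supported_entity_uniq]).  So for a selection matrix
    [F] the matrix [D] of supporters is diagonal with a positive diagonal, and
    the Perron-Frobenius theorem applies to [D^-1 *m C], where [C] is the matrix
    of repressors.  It yields a root [r > 0] with a positive right vector [u] and
    a positive left vector [p] of the pencil: [C *m u = r *: (D *m u)] and
    [p *m C = r *: (p *m D)] ([subsystem_perron]).

    The system can only select, for each entity, one column among those of its
    supporters, and these choices are independent.  Take a selection whose root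
    [r] is smallest, with its left vector [p].  If some affector [j] had
    [(p *m A) j < r * (p *m B) j], selecting [j] for the entity it supports would
    give a sub-system with a root below [r]; to see it, evaluate the pencil of
    the new sub-system between [p] and its own positive right vector.  Hence
    [r * (p *m B) <= p *m A] over all affectors ([min_choice_dual]).  So [p] is a
    dual certificate: from [A *m X <= beta^-1 *: (B *m X)] one gets
    [r * (p *m B *m X) <= beta^-1 * (p *m B *m X)], with [p *m B *m X > 0], hence
    [beta <= 1 / r] ([feasible_le_of_dual]).  The bound is attained at
    [P = F *m u], which satisfies [A *m P = r *: (B *m P)] and is positive
    exactly at the [n] selected affectors.

    Perron-Frobenius itself is proved through the largest [t] such that
    [t *: x <= x *m Z] for some [x] in the simplex; it exists by compactness
    ([maximal_subinvariant]).  Left and right vectors come from one statement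
    applied to [Z] and its transpose, and have the same root because both are
    positive. *)

Set Implicit Arguments.
Unset Strict Implicit.
Unset Printing Implicit Defensive.

Import Order.TTheory GRing.Theory Num.Theory.
Local Open Scope ring_scope.

(** * Nonnegative and positive matrices *)

Lemma scalemxE (R : pzRingType) (m n : nat) a (M : 'M[R]_(m, n)) i j :
  (a *: M) i j = a * M i j.
Proof. exact: mxE. Qed.

Lemma positive_lower_bound (R : realDomainType) (I : finType) (a : I -> R) :
  (forall i, 0 < a i) -> exists2 e, 0 < e & forall i, e <= a i.
Proof.
move=> a_gt0; exists (\big[Num.min/1]_i a i); last by move=> i; exact: bigmin_le_cond.
by apply: lt_bigmin => // i _.
Qed.

Lemma psumr_gt0 (R : numDomainType) (I : finType) (a : I -> R) (i : I) :
  (forall j, 0 <= a j) -> 0 < a i -> 0 < \sum_j a j.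
Proof.
move=> a_ge0 ai_gt0; rewrite (bigD1 i) //= ltr_pwDl //.
by apply: sumr_ge0.
Qed.

Lemma mulmx_ge0 (R : numDomainType) (m n p : nat) (M : 'M[R]_(m, n))
    (N : 'M[R]_(n, p)) :
  (forall i j, 0 <= M i j) -> (forall i j, 0 <= N i j) ->
  forall i j, 0 <= (M *m N) i j.
Proof. by move=> M0 N0 i j; rewrite mxE sumr_ge0 // => k _; apply: mulr_ge0. Qed.

Lemma mulmx_gt0 (R : numDomainType) (m n p : nat) (M : 'M[R]_(m, n))
    (N : 'M[R]_(n, p)) i j k :
  (forall i j, 0 <= M i j) -> (forall i j, 0 <= N i j) ->
  0 < M i j -> 0 < N j k -> 0 < (M *m N) i k.
Proof.
move=> M0 N0 Mij Njk; rewrite mxE; apply: (@psumr_gt0 _ _ _ j); last exact: mulr_gt0.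
by move=> l; apply: mulr_ge0.
Qed.

Lemma expmx_ge0 (R : numDomainType) (n k : nat) (M : 'M[R]_n) :
  (forall i j, 0 <= M i j) -> forall i j, 0 <= (M ^+ k) i j.
Proof.
move=> M0; elim: k => [|k IHk] i j.
  by rewrite expr0 mxE; case: (_ == _); rewrite ?mulr1n ?mulr0n.
by rewrite exprS; apply: mulmx_ge0.
Qed.

Lemma mul_row_col_gt0 (R : numDomainType) (n : nat) (w : 'rV[R]_n) (u : 'cV[R]_n) i :
  (forall j, 0 <= w 0 j) -> (forall j, 0 <= u j 0) -> 0 < w 0 i -> 0 < u i 0 ->
  0 < (w *m u) 0 0.
Proof.
by move=> w_ge0 u_ge0; apply: mulmx_gt0 => k l; rewrite ord1.
Qed.

Lemma ler_mul_row_col (R : numDomainType) (n : nat) (v w : 'rV[R]_n) (u : 'cV[R]_n) :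
  (forall j, v 0 j <= w 0 j) -> (forall j, 0 <= u j 0) ->
  (v *m u) 0 0 <= (w *m u) 0 0.
Proof.
by move=> vw u_ge0; rewrite !mxE; apply: ler_sum => j _; apply: ler_wpM2r.
Qed.

(** * The Perron-Frobenius theorem *)

(** Multiplication by such an [S] turns a nonnegative nonzero vector into a
    positive one without disturbing the relation of that vector to [Z], and
    unlike irreducibility the data transposes at once.  A sum of powers of [Z]
    works, one power for each entry. *)
Lemma irreducible_positive_commutant (R : realType) (n : nat) (Z : 'M[R]_n) :
  (forall i j, 0 <= Z i j) -> irreducible_mx Z ->
  exists2 S : 'M[R]_n, (forall i j, 0 < S i j) & S *m Z = Z *m S.
Proof.
move=> Z0 irrZ.
have [k Hk] : exists k : 'I_n * 'I_n -> nat, forall p, 0 < (Z ^+ k p) p.1 p.2.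
  apply: (@fin_all_exists _ (fun=> nat) (fun p k => is_true (0 < (Z ^+ k) p.1 p.2))).
  by move=> p; have [k [_ ?]] := irrZ p.1 p.2; exists k.
exists (\sum_p Z ^+ k p).
  move=> i j; rewrite summxE; apply: (@psumr_gt0 _ _ _ (i, j)); last exact: (Hk (i, j)).
  by move=> p; apply: expmx_ge0.
rewrite mulmx_suml mulmx_sumr; apply: eq_bigr => p _.
by apply: (esym (commrX _ _)).
Qed.

Section Compactness.
Import all_classical topology normedtype derive.
Import numFieldNormedType.Exports.
Local Open Scope classical_set_scope.

(** The value [t] is kept as a component of the point, so that the set is cut out
    by weak inequalities between continuous functions; the alternative, the
    minimum of the quotients [(x *m Z) j / x j], is not continuous where an entry
    of [x] vanishes. *)
Definition subinvariant (R : realType) (n : nat) (Z : 'M[R]_n) : set (R * 'rV[R]_n) :=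
  [set p : R * 'rV[R]_n | [/\ 0 <= p.1, forall j, 0 <= p.2 0 j, \sum_j p.2 0 j = 1
            & forall j, p.1 * p.2 0 j <= (p.2 *m Z) 0 j]].

(** Summing [t * x j <= (x *m Z) j] over [j] bounds [t] by the sum of the entries
    of [Z], so this closed set lies in a box. *)
Lemma subinvariant_compact (R : realType) (n : nat) (Z : 'M[R]_n) :
  (forall i j, 0 <= Z i j) -> compact (subinvariant Z).
Proof.
move=> Z0.
have ctsc j : continuous (fun p : R * 'rV[R]_n => p.2 0 j).
  by move=> p; apply: (continuous_comp (f := snd) (g := fun v : 'rV[R]_n => v 0 j));
    [exact: cvg_snd|exact: coord_continuous].
have ctss (a : 'I_n -> R) :
    continuous (fun p : R * 'rV[R]_n => \sum_j p.2 0 j * a j).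
  apply: continuous_big; first exact: add_continuous.
  by move=> j _ p; apply: cvgM; [exact: ctsc|exact: cvg_cst].
have ctsZ j : continuous (fun p : R * 'rV[R]_n => (p.2 *m Z) 0 j - p.1 * p.2 0 j).
  move=> p; under eq_fun do rewrite mxE.
  by apply: cvgB; [exact: ctss|apply: cvgM; [exact: cvg_fst|exact: ctsc]].
have ctss1 : continuous (fun p : R * 'rV[R]_n => \sum_j p.2 0 j).
  move=> p; have := @ctss (fun=> 1) p.
  by under eq_fun do under eq_bigr do rewrite mulr1.
have cl : closed (subinvariant Z).
  have -> : subinvariant Z = (fst @^-1` [set x | 0 <= x]) `&`
     (\bigcap_j (fun p : R * 'rV[R]_n => p.2 0 j) @^-1` [set x | 0 <= x]) `&`
     ((fun p : R * 'rV[R]_n => \sum_j p.2 0 j) @^-1` [set 1]) `&`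
     (\bigcap_j (fun p : R * 'rV[R]_n => (p.2 *m Z) 0 j - p.1 * p.2 0 j) @^-1` [set x | 0 <= x]).
    apply/seteqP; split=> -[t x] /=.
      move=> [t0 x0 x1 xZ]; do !split => //.
        by move=> j _ /=.
      by move=> j _ /=; rewrite subr_ge0.
    move=> [[[t0 x0] x1] xZ]; split => // j; first exact: x0.
    by rewrite -subr_ge0; exact: xZ.
  do !apply: closedI.
  - apply: preimage_closed; last exact: closed_ge.
    by move=> p _; exact: cvg_fst.
  - by apply: closed_bigI => j _; apply: preimage_closed; [move=> ? _; exact: ctsc|exact: closed_ge].
  - by apply: preimage_closed; [move=> ? _; exact: ctss1|exact: closed_eq].
  - by apply: closed_bigI => j _; apply: preimage_closed; [move=> ? _; exact: ctsZ|exact: closed_ge].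
pose M := \sum_i \sum_j Z i j.
apply: (subclosed_compact cl (B := `[0, M] `*` [set v : 'rV[R]_n | forall i, `[0, 1] (v ord0 i)])).
  apply: compact_setX; first exact: segment_compact.
  by apply: (@rV_compact R n (fun=> `[0, 1])) => i; exact: segment_compact.
move=> [t x] [/= t0 x0 x1 xZ].
have xle1 i : x 0 i <= 1.
  by rewrite -x1 (bigD1 i) //= lerDl sumr_ge0.
split=> /=; last by move=> i; rewrite in_itv /= x0 xle1.
rewrite in_itv /= t0 -[t]mulr1 -x1 mulr_sumr /=.
apply: (le_trans (ler_sum _ (fun j _ => xZ j))).
rewrite /M exchange_big; apply: ler_sum => j _; rewrite mxE; apply: ler_sum => i _.
by rewrite ler_piMl.
Qed.

Lemma maximal_subinvariant (R : realType) (n : nat) (Z : 'M[R]_n) :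
  (0 < n)%N -> (forall i j, 0 <= Z i j) ->
  exists2 p, subinvariant Z p & forall q, subinvariant Z q -> q.1 <= p.1.
Proof.
move=> n0 Z0.
have K0 : subinvariant Z !=set0.
  exists (0, delta_mx 0 (Ordinal n0)); split => //=.
  - by move=> j; rewrite mxE; case: (_ && _).
  - rewrite (bigD1 (Ordinal n0)) //= big1 ?addr0 ?mxE ?eqxx // => j /negPf jn.
    by rewrite mxE eqxx jn.
  - move=> j; rewrite mul0r mulmx_ge0 // => i k.
    by rewrite mxE; case: (_ && _).
have ctsfst : {within subinvariant Z, continuous (fst : R * 'rV[R]_n -> R)}.
  by apply: continuous_subspaceT => p; exact: cvg_fst.
have [p pK pmax] := compact_EVT_max K0 (subinvariant_compact Z0) ctsfst.
exists p; first exact: set_mem.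
by move=> q qK; apply: pmax; exact: mem_set.
Qed.

End Compactness.

Lemma subinvariant_normalize (R : realType) (n : nat) (Z : 'M[R]_n) t
    (y : 'rV[R]_n) :
  (0 < n)%N -> 0 <= t -> (forall j, 0 < y 0 j) ->
  (forall j, t * y 0 j <= (y *m Z) 0 j) ->
  exists x, subinvariant Z (t, x).
Proof.
move=> n_gt0 t_ge0 y_gt0 yZ; pose c := \sum_j y 0 j.
have c_gt0 : 0 < c.
  by apply: (@psumr_gt0 _ _ _ (Ordinal n_gt0)) => // j; exact: ltW.
exists (c^-1 *: y); split=> //=.
- by move=> j; rewrite mxE mulr_ge0 ?invr_ge0 ?ltW.
- under eq_bigr do rewrite mxE.
  by rewrite -mulr_sumr mulVf ?gt_eqF.
- by move=> j; rewrite -scalemxAl !scalemxE mulrCA ler_pM2l ?invr_gt0.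
Qed.

(** At the maximal [t], with its vector [x], the defect [v = x *m Z - t *: x] is
    nonnegative.  If it were nonzero, [v *m S] would be positive; but that is the
    defect of [x *m S], so [t] could be increased.  The positive eigenvector is
    [x *m S] rather than [x], which saves proving that [x] is positive. *)
Lemma perron_row (R : realType) (n : nat) (Z S : 'M[R]_n) :
  (0 < n)%N -> (forall i j, 0 <= Z i j) ->
  (forall i j, 0 < S i j) -> S *m Z = Z *m S ->
  exists t (x : 'rV[R]_n), (forall j, 0 < x 0 j) /\ x *m Z = t *: x.
Proof.
move=> n_gt0 Z_ge0 S_gt0 SZ.
have [[t x] [/= t_ge0 x_ge0 x1 xZ] tmax] := maximal_subinvariant n_gt0 Z_ge0.
have S_pos (v : 'rV[R]_n) : (forall i, 0 <= v 0 i) -> v != 0 ->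
    forall j, 0 < (v *m S) 0 j.
  move=> v_ge0 v_neq0 j.
  have [i vi_gt0] : exists i, 0 < v 0 i.
    apply/existsP; apply: contraNT v_neq0 => /existsPn v_le0.
    by apply/eqP/rowP => i; apply/eqP; rewrite mxE eq_le v_ge0 leNgt v_le0.
  apply: (@mulmx_gt0 _ _ _ _ _ _ 0 i) => // k l; last exact: ltW.
  by rewrite ord1.
have x_neq0 : x != 0.
  apply: contra_eq_neq x1 => ->; rewrite big1 ?(eq_sym 0) ?oner_eq0 // => j _.
  by rewrite mxE.
pose y := x *m S; have y_gt0 := S_pos x x_ge0 x_neq0.
exists t, y; split=> //; pose v := x *m Z - t *: x.
have yZ : y *m Z - t *: y = v *m S.
  by rewrite /y -mulmxA SZ mulmxA scalemxAl -mulmxBl.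
apply/eqP; rewrite -subr_eq0 yZ.
have [->|v_neq0] := eqVneq v 0; first by rewrite mul0mx.
have v_ge0 i : 0 <= v 0 i by rewrite mxE [(- (t *: x)) 0 i]mxE scalemxE subr_ge0.
have gap_gt0 j : 0 < (v *m S) 0 j / y 0 j by rewrite divr_gt0 ?S_pos.
(* The defect of [y] leaves room for raising [t] by [e] in every column. *)
have [e e_gt0 le_e] := positive_lower_bound gap_gt0.
have te_ge0 : 0 <= t + e by rewrite addr_ge0 // ltW.
have [|z /tmax /=] := subinvariant_normalize n_gt0 te_ge0 y_gt0 (Z := Z).
  move=> j; rewrite mulrDl -lerBrDl.
  have := le_e j; rewrite ler_pdivlMr // -yZ => /le_trans; apply.
  by rewrite mxE [(- (t *: y)) 0 j]mxE scalemxE.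
by rewrite gerDl leNgt e_gt0.
Qed.

Lemma perron_frobenius (R : realType) (n : nat) (Z : 'M[R]_n) :
  (0 < n)%N -> (forall i j, 0 <= Z i j) -> irreducible_mx Z ->
  exists r (w : 'rV[R]_n) (u : 'cV[R]_n),
    [/\ 0 < r, forall j, 0 < w 0 j, forall j, 0 < u j 0, w *m Z = r *: w
      & Z *m u = r *: u].
Proof.
move=> n_gt0 Z_ge0 irrZ.
have [S S_gt0 SZ] := irreducible_positive_commutant Z_ge0 irrZ.
have [r [w [w_gt0 wZ]]] := perron_row n_gt0 Z_ge0 S_gt0 SZ.
have [|||t [u [u_gt0 uZ]]] := @perron_row R n Z^T S^T n_gt0.
- by move=> i j; rewrite mxE.
- by move=> i j; rewrite mxE.
- by rewrite -!trmx_mul SZ.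
have Zu : Z *m u^T = t *: u^T by rewrite -[Z]trmxK -trmx_mul uZ linearZ.
have uT_gt0 j : 0 < u^T j 0 by rewrite mxE.
pose i0 := Ordinal n_gt0.
have wu_gt0 : 0 < (w *m u^T) 0 0.
  by apply: (@mul_row_col_gt0 _ _ _ _ i0) => // j; exact: ltW.
(* Both roots are read off the number [w *m Z *m u^T], and [w *m u^T] is positive. *)
have rt : r = t.
  have := congr1 (fun x : 'M__ => x 0 0) (mulmxA w Z u^T).
  rewrite Zu wZ -scalemxAr -scalemxAl mxE [RHS]mxE.
  by move/(mulIf (lt0r_neq0 wu_gt0)).
exists r, w, u^T; split=> //; last by rewrite Zu rt.
(* A positive diagonal entry of a power of [Z] forbids the root zero. *)
have [k [k_gt0 Zk]] := irrZ i0 i0.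
have wZk : w *m Z ^+ k = r ^+ k *: w.
  elim: k {k_gt0 Zk} => [|k IHk]; first by rewrite expr0 mulmx1 scale1r.
  by rewrite exprSr mulmxA IHk -scalemxAl wZ scalerA -exprSr.
have r_ge0 : 0 <= r.
  have : 0 <= (w *m Z) 0 i0 by apply: mulmx_ge0 => // i j; rewrite ord1 ltW.
  by rewrite wZ scalemxE pmulr_lge0.
rewrite lt_def r_ge0 andbT; apply/negP => /eqP r0.
have : 0 < (w *m Z ^+ k) 0 i0.
  apply: (@mulmx_gt0 _ _ _ _ _ _ 0 i0) => // [i j|]; first by rewrite ord1 ltW.
  exact: expmx_ge0.
by rewrite wZk r0 expr0n gtn_eqF //= scale0r mxE ltxx.
Qed.

(** For an eigenvector [v] of [a], the triangle inequality gives
    [`|a| *: `|v| <= `|v| *m Z]; pairing with [u] compares [`|a|] with [r]. *)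
Lemma eigenvalue_le_of_positive_vector (R : realType) (n : nat) (Z : 'M[R]_n) r
    (u : 'cV[R]_n) a :
  (forall i j, 0 <= Z i j) -> (forall i, 0 < u i 0) -> Z *m u = r *: u ->
  eigenvalue Z a -> a <= r.
Proof.
move=> Z_ge0 u_gt0 Zu /eigenvalueP [v vZ v_neq0].
have u_ge0 i : 0 <= u i 0 := ltW (u_gt0 i).
pose w := \row_j `|v 0 j|.
have [i vi_neq0] : exists i, v 0 i != 0.
  apply/existsP; apply: contraNT v_neq0 => /existsPn v0.
  by apply/eqP/rowP => i; rewrite mxE; apply/eqP; rewrite -[_ == _]negbK v0.
have wu_gt0 : 0 < (w *m u) 0 0.
  by apply: (@mul_row_col_gt0 _ _ _ _ i) => // [j|]; rewrite mxE ?normr_gt0.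
apply: (le_trans (ler_norm a)).
have : ((`|a| *: w) *m u) 0 0 <= (w *m Z *m u) 0 0.
  apply: ler_mul_row_col => // j; rewrite !mxE -normrM.
  have -> : a * v 0 j = (v *m Z) 0 j by rewrite vZ mxE.
  rewrite mxE (le_trans (ler_norm_sum _ _ _)) //; apply: ler_sum => k _.
  by rewrite normrM mxE (ger0_norm (Z_ge0 _ _)).
by rewrite -mulmxA Zu -scalemxAl -scalemxAr !scalemxE ler_pM2r.
Qed.

(** Used to pass from the repressors matrix to its product with the inverse of a
    positive diagonal matrix, which has the same pattern of zeros. *)
Lemma irreducible_mx_le (R : realType) (n : nat) (C Z : 'M[R]_n) c :
  0 < c -> (forall i j, 0 <= C i j) -> (forall i j, c * C i j <= Z i j) ->
  irreducible_mx C -> irreducible_mx Z.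
Proof.
move=> c_gt0 C_ge0 CZ irrC i j; have [k [k_gt0 Ck]] := irrC i j.
exists k; split=> //; apply: (@lt_le_trans _ _ (c ^+ k * (C ^+ k) i j)).
  by rewrite mulr_gt0 ?exprn_gt0.
elim: k i j {k_gt0 Ck} => [|k IHk] i j; first by rewrite !expr0 mul1r.
rewrite !exprSr [(C ^+ k * C) i j]mxE [leRHS]mxE mulr_sumr; apply: ler_sum => l _.
rewrite mulrACA; apply: ler_pM => //.
  by rewrite mulr_ge0 ?exprn_ge0 ?expmx_ge0 // ltW.
by rewrite mulr_ge0 // ltW.
Qed.

(** * Selections and square sub-systems *)

Definition selection_mx (R : realType) (n m : nat) (s : {ffun 'I_n -> 'I_m}) :
  'M[R]_(m, n) := \matrix_(j, i) (j == s i)%:R.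

(** Encoding selections by finite functions makes their set finite and the
    predicate decidable, so that a minimum over them exists. *)
Definition legal_choice (R : realType) (n m : nat) (g : 'M[R]_(n, m))
    (s : {ffun 'I_n -> 'I_m}) : bool := [forall i, 0 < g i (s i)].

Lemma mulmx_selection (R : realType) (n m k : nat) (M : 'M[R]_(k, m))
    (s : {ffun 'I_n -> 'I_m}) i j :
  (M *m selection_mx R s) i j = M i (s j).
Proof.
rewrite mxE (bigD1 (s j)) //= mxE eqxx mulr1 big1 ?addr0 // => l /negPf lj.
by rewrite mxE lj mulr0.
Qed.

Lemma legal_selectionP (R : realType) (n m : nat) (g : 'M[R]_(n, m)) F :
  legal_selection g F <-> exists2 s, legal_choice g s & F = selection_mx R s.
Proof.
split=> [[F01 Fex]|[s /forallP s_legal ->]]; last first.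
  split=> [j i|i]; first by rewrite mxE; case: eqP => _; [right|left].
  exists (s i); split; rewrite ?mxE ?eqxx ?inE //.
  by move=> j; rewrite mxE; case: eqP => // _ /eqP; rewrite eq_sym oner_eq0.
have [s Hs] := fin_all_exists Fex; exists (finfun s).
  by apply/forallP => i; rewrite ffunE; case: (Hs i) => _ _; rewrite inE.
apply/matrixP => j i; rewrite mxE ffunE; case: (Hs i) => Fsi Funiq _.
have [->|ji] := eqVneq j (s i); first exact: Fsi.
by case: (F01 j i) => // /Funiq jsi; rewrite jsi eqxx in ji.
Qed.

Lemma legal_choice_ex (R : realType) (n m : nat) (g : 'M[R]_(n, m)) :
  (forall i, supporters g i != set0) -> exists s, legal_choice g s.
Proof.
move=> supp_neq0.
have [s Hs] : exists s : 'I_n -> 'I_m, forall i, 0 < g i (s i).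
  apply: (@fin_all_exists _ (fun=> 'I_m) (fun i j => is_true (0 < g i j))) => i.
  by have /set0Pn [j] := supp_neq0 i; rewrite inE; exists j.
by exists (finfun s); apply/forallP => i; rewrite ffunE.
Qed.

Lemma legal_choice_update (R : realType) (n m : nat) (g : 'M[R]_(n, m)) s k j :
  legal_choice g s -> 0 < g k j ->
  legal_choice g [ffun i => if i == k then j else s i].
Proof.
move=> /forallP s_legal gkj; apply/forallP => i.
by rewrite ffunE; case: eqP => [->|].
Qed.

Lemma supporters_mx_ge0 (R : realType) (n m : nat) (g : 'M[R]_(n, m)) i j :
  0 <= supporters_mx g i j.
Proof. by rewrite mxE le_max lexx orbT. Qed.

Lemma repressors_mx_ge0 (R : realType) (n m : nat) (g : 'M[R]_(n, m)) i j :
  0 <= repressors_mx g i j.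
Proof. by rewrite mxE le_max lexx orbT. Qed.

Lemma supporters_mx_gt0 (R : realType) (n m : nat) (g : 'M[R]_(n, m)) i j :
  (0 < supporters_mx g i j) = (0 < g i j).
Proof. by rewrite mxE lt_max ltxx orbF. Qed.

(** A legal selection giving [j] to two entities [i] and [k] would produce a
    singular supporters matrix; [s] fills in the other entities. *)
Lemma supported_entity_uniq (R : realType) (n m : nat) (g : 'M[R]_(n, m)) s i k j :
  irreducible_system g -> legal_choice g s ->
  0 < g i j -> 0 < g k j -> i = k.
Proof.
move=> irr s_legal gij gkj; apply/eqP; apply/negP => /negP ik.
pose t := [ffun l => if l == k then j else [ffun l => if l == i then j else s l] l].
have t_legal : legal_choice g t by do 2!apply: legal_choice_update => //.
have [] := irr (selection_mx R t); first by apply/legal_selectionP; exists t.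
rewrite unitmxE -det_tr (determinant_alternate ik) ?unitr0 // => l.
rewrite [LHS]mxE [RHS]mxE !mulmx_selection !ffunE !eqxx.
by case: (_ == _).
Qed.

Lemma supporters_mx_selection (R : realType) (n m : nat) (g : 'M[R]_(n, m)) s i k :
  irreducible_system g -> legal_choice g s ->
  (supporters_mx g *m selection_mx R s) i k = g i (s i) *+ (i == k).
Proof.
move=> irr s_legal; rewrite mulmx_selection mxE; have /forallP s_gt0 := s_legal.
have [->|ik] := eqVneq i k; first by apply/max_idPl/ltW.
apply/max_idPr; rewrite leNgt; apply/negP => gik.
by move/negP: ik; apply; apply/eqP/(supported_entity_uniq irr s_legal gik).
Qed.

(** The left vector of the pencil is [w *m D^-1], where [w] is the left
    eigenvector of [D^-1 *m C]; the right vector is the same for both. *)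
Lemma subsystem_perron (R : realType) (n m : nat) (g : 'M[R]_(n, m)) s :
  (0 < n)%N -> irreducible_system g -> legal_choice g s ->
  let F := selection_mx R s in
  exists r (p : 'rV[R]_n) (u : 'cV[R]_n),
    [/\ 0 < r /\ is_PF_root (subsystem_mx g F) r,
        forall i, 0 < p 0 i, forall i, 0 < u i 0,
        p *m (repressors_mx g *m F) = r *: (p *m (supporters_mx g *m F))
      & (repressors_mx g *m F) *m u = r *: (supporters_mx g *m F *m u)].
Proof.
move=> n_gt0 irr s_legal F; have /forallP s_gt0 := s_legal.
have [] : supporters_mx g *m F \in unitmx /\ irreducible_mx (repressors_mx g *m F).
  by apply: irr; apply/legal_selectionP; exists s.
set D := supporters_mx g *m F; set C := repressors_mx g *m F => unitD irrC.
have DE i k : D i k = g i (s i) *+ (i == k) by exact: supporters_mx_selection.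
pose Z := subsystem_mx g F.
have DZ : D *m Z = C by rewrite mulmxA mulmxV // mul1mx.
have C_ge0 i j : 0 <= C i j by rewrite mulmx_selection repressors_mx_ge0.
have ZE i j : Z i j = (g i (s i))^-1 * C i j.
  rewrite -DZ [X in _ * X]mxE (bigD1 i) //= DE eqxx mulr1n big1 ?addr0 => [|l /negPf li].
    by rewrite mulKf // gt_eqF.
  by rewrite DE eq_sym li mul0r.
have Z_ge0 i j : 0 <= Z i j by rewrite ZE mulr_ge0 // invr_ge0 ltW.
have gV_gt0 i : 0 < (g i (s i))^-1 by rewrite invr_gt0.
have [c c_gt0 c_le] := positive_lower_bound gV_gt0.
have irrZ : irreducible_mx Z.
  by apply: (irreducible_mx_le c_gt0 C_ge0) => // i j; rewrite ZE ler_wpM2r.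
have [r [w [u [r_gt0 w_gt0 u_gt0 wZ Zu]]]] := perron_frobenius n_gt0 Z_ge0 irrZ.
have pD : w *m invmx D *m D = w by rewrite mulmxKV.
exists r, (w *m invmx D), u; split=> //.
- split=> //; split=> [|a]; last exact: (eigenvalue_le_of_positive_vector Z_ge0 u_gt0).
  apply/eigenvalueP; exists w => //; apply/eqP => /rowP /(_ (Ordinal n_gt0)).
  by rewrite mxE; apply/eqP; rewrite gt_eqF.
- move=> i; have := w_gt0 i; rewrite -{1}pD mxE (bigD1 i) //= big1 => [|l /negPf li].
    by rewrite DE eqxx mulr1n addr0 pmulr_lgt0.
  by rewrite DE li mulr0.
- by rewrite -DZ mulmxA pD wZ.
- by rewrite -DZ -mulmxA Zu scalemxAr.
Qed.

(** * The dual certificate and the optimal value *)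

(** If the inequality failed at [j], let [t] be [s] with [j] selected for [k], with
    sub-system [(C, D)], root [rt] and positive right vector [u].  The vector
    [v = r *: (p *m D) - p *m C] vanishes outside [k] and is positive at [k], so
    [v *m u > 0]; but [v *m u = (r - rt) * (p *m D *m u)], and [r <= rt] by
    minimality. *)
Lemma min_choice_dual (R : realType) (n m : nat) (g : 'M[R]_(n, m)) s r
    (p : 'rV[R]_n) :
  (0 < n)%N -> irreducible_system g -> legal_choice g s ->
  p *m (repressors_mx g *m selection_mx R s) =
    r *: (p *m (supporters_mx g *m selection_mx R s)) ->
  (forall t rt, legal_choice g t ->
     is_PF_root (subsystem_mx g (selection_mx R t)) rt -> r <= rt) ->
  (forall i, 0 < p 0 i) ->
  forall k j, 0 < g k j ->
    r * (p *m supporters_mx g) 0 j <= (p *m repressors_mx g) 0 j.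
Proof.
move=> n_gt0 irr s_legal pC r_min p_gt0 k j gkj; rewrite leNgt; apply/negP => better.
pose t := [ffun i => if i == k then j else s i].
have t_legal : legal_choice g t by exact: legal_choice_update.
have [rt [_ [u [[_ rtP] _ u_gt0 _ Cu]]]] := subsystem_perron n_gt0 irr t_legal.
have r_le := r_min t rt t_legal rtP.
set F := selection_mx R t in Cu.
pose v := r *: (p *m (supporters_mx g *m F)) - p *m (repressors_mx g *m F).
have vE i : v 0 i = r * (p *m supporters_mx g) 0 (t i) - (p *m repressors_mx g) 0 (t i).
  rewrite /v !mulmxA mxE scalemxE mulmx_selection.
  by rewrite [(- (_ : 'M__)) 0 i]mxE mulmx_selection.
have vu_gt0 : 0 < (v *m u) 0 0.
  apply: (@mul_row_col_gt0 _ _ _ _ k) => // [i|i|]; last by rewrite vE ffunE eqxx subr_gt0.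
    rewrite vE ffunE; case: eqP => [_|_]; first by rewrite subr_ge0 ltW.
    rewrite -(mulmx_selection _ s) -[X in _ - X](mulmx_selection _ s) -!mulmxA pC.
    by rewrite scalemxE subrr.
  exact: ltW.
have vu : v *m u = (r - rt) *: (p *m (supporters_mx g *m F *m u)).
  rewrite /v mulmxBl -scalemxAl -(mulmxA p (repressors_mx g *m F)) Cu.
  by rewrite -scalemxAr -(mulmxA p (supporters_mx g *m F)) scalerBl.
have : (v *m u) 0 0 <= 0.
  rewrite vu scalemxE; apply: mulr_le0_ge0; first by rewrite subr_le0.
  apply: mulmx_ge0 => [i l|]; first by rewrite ord1 ltW.
  apply: mulmx_ge0 => i l; last by rewrite ord1 ltW.
  by rewrite mulmx_selection supporters_mx_ge0.
by rewrite leNgt vu_gt0.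
Qed.

(** Weak duality for the program, [p] being the dual vector. *)
Lemma feasible_le_of_dual (R : realType) (n m : nat) (A B : 'M[R]_(n, m)) r
    (p : 'rV[R]_n) beta X :
  0 < r -> (forall i, 0 < p 0 i) -> (forall j, 0 < (p *m B) 0 j) ->
  (forall j, r * (p *m B) 0 j <= (p *m A) 0 j) ->
  feasible A B beta X -> beta <= r^-1.
Proof.
move=> r_gt0 p_gt0 pB_gt0 pA [beta_gt0 AX X1 X_ge0'].
have X_ge0 j : 0 <= X j 0 by have := X_ge0' j; rewrite mxE.
have [j Xj_gt0] : exists j, 0 < X j 0.
  apply/existsP; apply: contra_eqT X1 => /existsPn X_le0.
  rewrite big1 ?(eq_sym 0) ?oner_eq0 // => j _; apply/eqP.
  by rewrite normr_eq0 eq_le X_ge0 leNgt X_le0.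
have pBX_gt0 : 0 < (p *m B *m X) 0 0.
  by apply: (@mul_row_col_gt0 _ _ _ _ j) => // i; exact: ltW.
have lower : r * (p *m B *m X) 0 0 <= (p *m A *m X) 0 0.
  rewrite -scalemxE scalemxAl; apply: ler_mul_row_col => // i.
  by rewrite scalemxE.
have upper : (p *m A *m X) 0 0 <= beta^-1 * (p *m B *m X) 0 0.
  rewrite -!mulmxA -scalemxE scalemxAr !mxE; apply: ler_sum => i _.
  by rewrite ler_wpM2l ?AX // ltW.
have := le_trans lower upper; rewrite ler_pM2r // => le_r.
by rewrite -[beta]invrK lef_pV2 // posrE invr_gt0.
Qed.

Lemma selection_mul_pos (R : realType) (n m : nat) (s : {ffun 'I_n -> 'I_m})
    (u : 'cV[R]_n) j :
  (forall i, 0 < u i 0) ->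
  (0 <= (selection_mx R s *m u) j 0) *
  ((0 < (selection_mx R s *m u) j 0) = (j \in s @: setT)).
Proof.
move=> u_gt0.
have F_ge0 i k : 0 <= selection_mx R s i k by rewrite mxE ler0n.
have Fu_ge0 : 0 <= (selection_mx R s *m u) j 0.
  by apply: mulmx_ge0 => // i k; rewrite ord1 ltW.
split=> //; apply/idP/idP => [|/imsetP [i _ ->]].
  apply: contraTT => js; rewrite mxE big1 ?ltxx // => i _.
  by rewrite mxE; case: eqP => [ji|_]; [rewrite ji imset_f in js|rewrite mul0r].
apply: (@mulmx_gt0 _ _ _ _ _ _ _ i) => // [k l|]; first by rewrite ord1 ltW.
by rewrite mxE eqxx ltr01.
Qed.

Theorem theorem1p2 (R : realType) (n m : nat) (g A B : 'M[R]_(n, m))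
    (n_gt0 : (0 < n)%N) (le_nm : (n <= m)%N)
    (supp_neq0 : forall i, supporters g i != set0)
    (no_redundant : forall j, exists i, 0 < g i j)
    (irr : irreducible_system g)
    (defA : A = repressors_mx g) (defB : B = supporters_mx g) :
  exists beta r : R,
    [/\ is_optimal_value A B beta,
        is_min_PF_root g r,
        0 < r,
        beta = 1 / r
      & exists P : 'cV[R]_m,
          [/\ le_cV 0 P,
              A *m P = r *: (B *m P),
              #|[set j | 0 < P j 0]| = n
            & #|[set j | P j 0 == 0]| = (m - n)%N]].
Proof.
have [s0 s0_legal] := legal_choice_ex supp_neq0.
have [rho rhoP] : exists rho : {ffun 'I_n -> 'I_m} -> R, forall s, legal_choice g s ->
    is_PF_root (subsystem_mx g (selection_mx R s)) (rho s).
  apply: (@fin_all_exists _ (fun=> R) (fun s r => legal_choice g s -> is_PF_root _ r)).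
  move=> s; have [s_legal|_] := boolP (legal_choice g s); last by exists 0.
  by have [r [_ [_ [[_ rP] _ _ _ _]]]] := subsystem_perron n_gt0 irr s_legal; exists r.
pose s := [arg min_(t < s0 | legal_choice g t) rho t]%O.
have [s_legal rho_min] : legal_choice g s /\
    forall t, legal_choice g t -> rho s <= rho t.
  by rewrite /s; case: arg_minP.
(* Identifies the root supplied with the vectors [p] and [u] with [rho s]. *)
have PF_root_uniq C (a b : R) : @is_PF_root R n C a -> is_PF_root C b -> a = b.
  by move=> [Ca aP] [Cb bP]; apply/le_anti/andP; split; [exact: bP|exact: aP].
have [r [p [u [[r_gt0 rP] p_gt0 u_gt0 pC Cu]]]] := subsystem_perron n_gt0 irr s_legal.
have rE : r = rho s := PF_root_uniq _ _ _ rP (rhoP s s_legal).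
have r_min t rt : legal_choice g t ->
    is_PF_root (subsystem_mx g (selection_mx R t)) rt -> r <= rt.
  move=> t_legal rtP; rewrite rE (PF_root_uniq _ _ _ rtP (rhoP t t_legal)).
  exact: rho_min.
have dual := min_choice_dual n_gt0 irr s_legal pC r_min p_gt0.
pose P := selection_mx R s *m u.
have AP : A *m P = r *: (B *m P) by rewrite defA defB /P !mulmxA Cu.
have PE j := selection_mul_pos s j u_gt0.
have s_inj : injective s.
  have /forallP s_gt0 := s_legal => i k sik.
  by apply: (supported_entity_uniq irr s_legal (s_gt0 i)); rewrite sik.
have suppP : [set j | 0 < P j 0] = s @: setT by apply/setP => j; rewrite inE PE.
have cardP : #|[set j | 0 < P j 0]| = n.
  by rewrite suppP card_imset // cardsT card_ord.
exists r^-1, r; split=> //; last 1 first.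
- exists P; split=> //; first by move=> j; rewrite mxE PE.
  have -> : [set j | P j 0 == 0] = ~: [set j | 0 < P j 0].
    by apply/setP => j; rewrite !inE lt_def PE andbT negbK.
  by rewrite cardsCs setCK cardP card_ord.
- split; last first.
    move=> beta X; apply: (feasible_le_of_dual r_gt0 p_gt0).
      move=> j; have [i gij] := no_redundant j.
      rewrite defB; apply: (@mulmx_gt0 _ _ _ _ _ _ 0 i) => // [k l|k l|].
      - by rewrite ord1 ltW.
      - exact: supporters_mx_ge0.
      - by rewrite supporters_mx_gt0.
    by move=> j; have [i gij] := no_redundant j; rewrite defA defB (dual i).
  pose c := \sum_j P j 0.
  have c_gt0 : 0 < c.
    apply: (@psumr_gt0 _ _ _ (s (Ordinal n_gt0))) => [j|]; first by rewrite PE.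
    by rewrite PE imset_f.
  exists (c^-1 *: P); split.
  + by rewrite invr_gt0.
  + by rewrite invrK -!scalemxAr AP scalerA mulrC -scalerA => i.
  + under eq_bigr do rewrite mxE normrM !ger0_norm ?invr_ge0 ?(ltW c_gt0) ?PE //.
    by rewrite -mulr_sumr mulVf // gt_eqF.
  + by move=> j; rewrite mxE scalemxE mulr_ge0 ?invr_ge0 ?(ltW c_gt0) ?PE.
- split; first by exists (selection_mx R s); split=> //; apply/legal_selectionP; exists s.
  move=> F /legal_selectionP [t t_legal ->].
  by exists (rho t); split; [exact: rhoP|rewrite rE rho_min].
- by rewrite div1r.
Qed.
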